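(* Let $\mathscr{X}$ be a complex Banach space and let $\Delta$ be an invertible elementary operator of length $2$ on $\mathcal{L}(\mathscr{X})$. Suppose that $\Delta^{-1}$ is also an elementary operator of length $2$. Then there exist multiplication operators $\mathrm{M}_1,\mathrm{M}_2,\Gamma_1,\Gamma_2$ on $\mathcal{L}(\mathscr{X})$ such that $\Delta=\mathrm{M}_1+\mathrm{M}_2$, $\Delta^{-1}=\Gamma_1+\Gamma_2$, and one of the following assertions holds. (1) $\mathrm{M}_1$ and $\mathrm{M}_2$ are invertible. (2) $\Gamma_i\mathrm{M}_j=\mathrm{M}_j\Gamma_i=0$ for $i\neq j$.
   Context: $\mathcal{L}(\mathscr{X})$ is the algebra of bounded linear operators on $\mathscr{X}$. A multiplication operator on $\mathcal{L}(\mathscr{X})$ is a map $\mathrm{M}_{A,B}:T\mapsto ATB$ with $A,B\in\mathcal{L}(\mathscr{X})$. An elementary operator on $\mathcal{L}(\mathscr{X})$ is a finite sum of multiplication operators; its length is the minimum number of multiplication operators needed to represent it. Products are compositions, and invertibility means invertibility as a bounded linear operator on $\mathcal{L}(\mathscr{X})$. *)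

(* Defs.v *)
From HB Require Import structures.
From mathcomp Require Import all_boot all_order all_algebra.
From mathcomp Require Import complex.
From mathcomp Require Import all_classical all_reals.
From mathcomp Require Import topology normedtype.

Set Implicit Arguments.
Unset Strict Implicit.
Unset Printing Implicit Defensive.

Import Order.TTheory GRing.Theory Num.Theory.
Import numFieldNormedType.Exports.

Local Open Scope classical_set_scope.
Local Open Scope ring_scope.

Definition bounded_linear (R : realType) (V : normedModType R[i]) :
    {pred V -> V} :=
  fun f => `[< linear f /\ exists k : R[i], forall x, `|f x| <= k * `|x| >].

Section BoundedLinear.
Variables (R : realType) (V : normedModType R[i]).

Fact bounded_linear_submod_closed : submod_closed (@bounded_linear R V).
Proof.
split=> [|a f g /asboolP[lf [k kf]] /asboolP[lg [l gl]]]; apply/asboolP.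
  split=> [b u v|]; first by rewrite scaler0 addr0.
  by exists 0 => x; rewrite mul0r normr0.
split=> [b u v|].
  rewrite -![(a *: f + g) _]/(a *: f _ + g _) lf lg !scalerDr !scalerA.
  by rewrite [b * a]mulrC addrACA.
exists (`|a| * k + l) => x; rewrite -[(a *: f + g) x]/(a *: f x + g x).
by rewrite (le_trans (ler_normD _ _))// mulrDl normrZ -mulrA lerD// ler_wpM2l.
Qed.

HB.instance Definition _ :=
  GRing.isSubmodClosed.Build _ _ (@bounded_linear R V)
    bounded_linear_submod_closed.

End BoundedLinear.

(* L(V), with the operator norm and composition as multiplication. *)
Record bop (R : realType) (V : normedModType R[i]) := Bop {
  bop_fun :> V -> V;
  bop_boundedP : bop_fun \in @bounded_linear R V }.

Section Bop.
Variables (R : realType) (V : normedModType R[i]).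

HB.instance Definition _ := [isSub of bop V for @bop_fun R V].
HB.instance Definition _ := [Choice of bop V by <:].
HB.instance Definition _ := [SubChoice_isSubLmodule of bop V by <:].

Fact bop_linear (f : bop V) : linear f.
Proof. by case/asboolP: (bop_boundedP f). Qed.

HB.instance Definition _ (f : bop V) :=
  GRing.isLinear.Build R[i] V V *:%R f (bop_linear f).

Lemma bopP (f g : bop V) : (forall x, f x = g x) <-> f = g.
Proof. by split=> [fg|->//]; apply/val_inj/funext. Qed.

Lemma bop_bound (f : bop V) :
  exists2 k : R[i], 0 <= k & forall x, `|f x| <= k * `|x|.
Proof.
case/asboolP: (bop_boundedP f) => _ [k kf].
have [[y y0]|/forallNP n] := pselect (exists y : V, y != 0).
  exists k => //; have := le_trans (normr_ge0 _) (kf y).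
  by rewrite pmulr_lge0// normr_gt0.
exists 0 => // x; have /negP := n x; rewrite negbK => /eqP ->.
by rewrite raddf0 normr0 mulr0.
Qed.

Fact bop_id_subproof : idfun \in @bounded_linear R V.
Proof. by apply/asboolP; split=> //; exists 1 => x; rewrite mul1r. Qed.
Definition bop_id : bop V := Bop bop_id_subproof.

Fact bop_comp_subproof (f g : bop V) : f \o g \in @bounded_linear R V.
Proof.
apply/asboolP; split=> [a u v|]; first by rewrite /= !linearP.
have [k k0 kf] := bop_bound f; have [l _ lg] := bop_bound g.
by exists (k * l) => x /=; rewrite (le_trans (kf _))// -mulrA ler_wpM2l.
Qed.
Definition bop_comp (f g : bop V) : bop V := Bop (bop_comp_subproof f g).

Fact bop_compA : associative bop_comp.
Proof. by move=> f g h; apply/bopP. Qed.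
Fact bop_comp1l : left_id bop_id bop_comp.
Proof. by move=> f; apply/bopP. Qed.
Fact bop_comp1r : right_id bop_id bop_comp.
Proof. by move=> f; apply/bopP. Qed.
Fact bop_compDl : left_distributive bop_comp +%R.
Proof. by move=> f g h; apply/bopP. Qed.
Fact bop_compDr : right_distributive bop_comp +%R.
Proof. by move=> f g h; apply/bopP => x /=; rewrite !fctE raddfD. Qed.

HB.instance Definition _ := GRing.Zmodule_isPzRing.Build (bop V)
  bop_compA bop_comp1l bop_comp1r bop_compDl bop_compDr.

(* Norms on an R[i]-module take (real) values in R[i], whereas sup lives in R:
   hence the round trip through Re and %:C. *)
Definition opnorm (f : bop V) : R[i] :=
  (sup [set complex.Re `|f x| | x in [set x : V | `|x| <= 1%R]])%:C%C.

Lemma Re_norm (x : V) : (complex.Re `|x|)%:C%C = `|x|.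
Proof. by rewrite RRe_real// normr_real. Qed.

Lemma opnorm_has_sup (f : bop V) :
  has_sup [set complex.Re `|f x| | x in [set x : V | `|x| <= 1%R]].
Proof.
split; first by exists (complex.Re `|f 0|), 0; rewrite //= normr0.
have [k k0 kf] := bop_bound f; exists (complex.Re k) => _ [x /= x1 <-].
rewrite -lecR Re_norm RRe_real ?ger0_real//.
by rewrite (le_trans (kf x))// ler_piMr.
Qed.

Lemma opnorm_ge0 (f : bop V) : 0 <= opnorm f.
Proof.
rewrite ler0c; apply: le_trans (sup_upper_bound (opnorm_has_sup f) _) => /=.
  exact: (lexx 0).
by exists 0; rewrite /= ?raddf0 normr0.
Qed.

Lemma opnormP (f : bop V) (x : V) : `|f x| <= opnorm f * `|x|.
Proof.
have [->|x0] := eqVneq x 0; first by rewrite raddf0 !normr0 mulr0.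
have nx0 : 0 < `|x| by rewrite normr_gt0.
suff : `|f (`|x|^-1 *: x)| <= opnorm f.
  by rewrite linearZ normrZ normfV normr_id mulrC ler_pdivrMr.
rewrite -Re_norm lecR; apply: (sup_upper_bound (opnorm_has_sup f)).
by exists (`|x|^-1 *: x) => //=; rewrite normrZ normfV normr_id mulVf ?gt_eqF.
Qed.

Lemma opnorm_le (f : bop V) (k : R[i]) : 0 <= k ->
  (forall x, `|f x| <= k * `|x|) -> opnorm f <= k.
Proof.
move=> k0 kf; rewrite -[leRHS]RRe_real ?ger0_real// lecR.
apply: ge_sup; first by case: (opnorm_has_sup f).
move=> _ [x /= x1 <-]; rewrite -lecR Re_norm RRe_real ?ger0_real//.
by rewrite (le_trans (kf x))// ler_piMr.
Qed.

Fact opnormD (f g : bop V) : opnorm (f + g) <= opnorm f + opnorm g.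
Proof.
apply: opnorm_le => [|x]; first by rewrite addr_ge0 ?opnorm_ge0.
by rewrite mulrDl (le_trans (ler_normD _ _))// lerD ?opnormP.
Qed.

Fact opnormZ (a : R[i]) (f : bop V) : opnorm (a *: f) = `|a| * opnorm f.
Proof.
have le b g : opnorm (b *: g) <= `|b| * opnorm g.
  apply: opnorm_le => [|x]; first by rewrite mulr_ge0 ?opnorm_ge0.
  by rewrite [(b *: g) x]/(b *: g x) normrZ -mulrA ler_wpM2l ?opnormP.
apply/eqP; rewrite eq_le le/=; have [->|a0] := eqVneq a 0.
  by rewrite normr0 mul0r opnorm_ge0.
have := le a^-1 (a *: f).
by rewrite scalerA mulVf// scale1r normfV ler_pdivlMl ?normr_gt0.
Qed.

Fact opnorm_eq0 (f : bop V) : opnorm f = 0 -> f = 0.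
Proof.
move=> f0; apply/bopP => x; apply/normr0_eq0/eqP.
by rewrite eq_le normr_ge0 andbT -(mul0r `|x|) -f0 opnormP.
Qed.

HB.instance Definition _ :=
  Lmodule_isNormed.Build R[i] (bop V) opnormD opnormZ opnorm_eq0.

Lemma bop_normE (f : bop V) : `|f| = opnorm f. Proof. by []. Qed.

Lemma bop_mulE (f g : bop V) (x : V) : (f * g) x = f (g x).
Proof. by []. Qed.

End Bop.

Section Elementary.
Variables (R : realType) (V : normedModType R[i]).

Fact mulop_subproof (A B : bop V) :
  (fun T : bop V => A * T * B) \in @bounded_linear R (bop V).
Proof.
apply/asboolP; split=> [a S T|].
  by apply/bopP => x /=; rewrite !linearP.
exists (`|A| * `|B|) => T; apply: opnorm_le => [|x]; first by rewrite !mulr_ge0.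
rewrite (le_trans (opnormP A _))// -!mulrA ler_wpM2l ?opnorm_ge0//.
rewrite (le_trans (opnormP T _))// mulrCA ler_wpM2l ?opnorm_ge0//.
exact: opnormP.
Qed.

Definition mulop (A B : bop V) : bop (bop V) := Bop (mulop_subproof A B).

Lemma mulopE (A B T : bop V) : mulop A B T = A * T * B. Proof. by []. Qed.

Definition is_mulop (M : bop (bop V)) : Prop := exists A B, M = mulop A B.

Definition is_sum_mulop (n : nat) (D : bop (bop V)) : Prop :=
  exists A B : 'I_n -> bop V, D = \sum_(i < n) mulop (A i) (B i).

(* The empty sum is allowed, so that 0 has length 0 (not 1). *)
Definition elementary_of_length (n : nat) (D : bop (bop V)) : Prop :=
  is_sum_mulop n D /\ forall m, is_sum_mulop m D -> (n <= m)%N.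

Definition is_inverse (D E : bop (bop V)) : Prop := D * E = 1 /\ E * D = 1.

Definition invertible (D : bop (bop V)) : Prop := exists E, is_inverse D E.

End Elementary.

(* Main.v *)
From HB Require Import structures.
Require Import Defs.
From mathcomp Require Import all_boot all_order all_algebra.
From mathcomp Require Import ring complex.
From mathcomp Require Import all_classical all_reals.
From mathcomp Require Import topology normedtype.
Set Implicit Arguments.
Unset Strict Implicit.
Unset Printing Implicit Defensive.
Import Order.TTheory GRing.Theory Num.Theory.
Import numFieldNormedType.Exports.
Local Open Scope ring_scope.

(** Write M_{A,B} as the tensor [A (x) B]; sums of such tensors multiply by
    (A (x) B)(C (x) E) = AC (x) EB.  Let D = A1 (x) B1 + A2 (x) B2 have inverse
    G = C1 (x) D1 + C2 (x) D2, both of length 2.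

    Rank.  Operators on a normed space have enough rank-one elements
    (Hahn-Banach) for a vanishing sum of the a_i (x) b_i to vanish already in the
    algebraic tensor product ([nzbop_faithful]).  For such a sum with n terms,
    rank a + rank b <= n ([tensor_relation]).  As DG = 1 says that the sum of the
    four A_i C_j (x) D_j B_i, minus 1 (x) 1, is zero, either the four products
    A_i C_j or the four products D_j B_i span at most a plane.  Exchanging the two
    tensor factors is passing to the converse algebra, so the first may be assumed.

    Pencils.  Changing the bases of span(A1, A2) and span(C1, C2), with the dual
    changes on the B's and D's, leaves D and G alone.  Over an algebraically closed
    field, four bilinear products in a plane always include, for suitable bases, a
    vanishing one A1 C2 = 0; the other three are linearly dependent, and the relation
    reduces to A2 C1 = 0 or to A1 C1 = - A2 C2, the remaining degenerate relations
    being excluded by the invertibility of D ([normal_form]).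

    If A1 C2 = A2 C1 = 0, half of assertion (2) holds for DG, and comparing GD with 1
    gives the other half ([orthogonal_case]).  If A1 C1 = - A2 C2 = P, then either a
    further change of basis leads back to the first case, or P^2 = 0, A2 and B2 are
    invertible and A1 is a multiple of P A2 ([tangent_case]).  In the latter situation
    all A2 + t A1 are invertible, and B1 + t B2 and t B2 - B1 are invertible for large t
    by the Neumann series (the only place where completeness is used); rewriting D in
    the basis A2 + t A1, A2 - t A1 yields assertion (1) ([unit_case]). *)

(** * The converse of an algebra *)

Section ConverseAlgebra.
Variables (F : comNzRingType) (L : algType F).
HB.instance Definition _ := GRing.Lmodule.on L^c.
HB.instance Definition _ := GRing.Lmodule_isLalgebra.Build F L^c
  (fun k x y => scalerAr k (y : L) (x : L)).
HB.instance Definition _ := GRing.Lalgebra_isAlgebra.Build F L^c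
  (fun k x y => scalerAl k (y : L) (x : L)).
End ConverseAlgebra.

(** * Relations between simple tensors *)

Section Independence.
Variables (F : fieldType) (L : algType F).

Definition lin_indep (I : finType) (J : {set I}) (a : I -> L) :=
  forall c : I -> F, \sum_(i in J) c i *: a i = 0 -> forall i, i \in J -> c i = 0.

(** Faithfulness of the map from L (x) L^op to the maps L -> L, restated without tensor
    products.  The mirror statement, with independent b's, is [left_faithful L^c]. *)
Definition left_faithful :=
  forall (I : finType) (J : {set I}) (a b : I -> L),
    (forall T, \sum_(i in J) a i * T * b i = 0) -> lin_indep J a ->
    forall i, i \in J -> b i = 0.

Definition span2 (p q x : L) := exists s t : F, x = s *: p + t *: q.

Definition is_unit (a : L) := exists b, a * b = 1 /\ b * a = 1.

Lemma max_lin_indep (I : finType) (a : I -> L) :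
  exists2 J : {set I}, lin_indep J a &
    exists c : I -> I -> F, forall i, a i = \sum_(j in J) c i j *: a j.
Proof.
have ind0 : `[< lin_indep finset.set0 a >].
  by apply/asboolP => c _ i; rewrite inE.
case: (arg_maxnP (P := fun J => `[< lin_indep J a >]) (fun J => #|J|) ind0).
move=> J /asboolP Jind Jmax.
exists J => //; suff aJ i : exists c : I -> F, a i = \sum_(j in J) c j *: a j.
  by exists (fun i => sval (cid (aJ i))) => i; case: cid.
have [iJ|iJ] := boolP (i \in J).
  exists (fun j => (j == i)%:R); rewrite (bigD1 i)//= eqxx scale1r big1 ?addr0//.
  by move=> j /andP[_ /negPf->]; rewrite scale0r.
have /existsNP [c /not_implyP []] : ~ lin_indep (i |: J) a.
  by move=> /asboolP/Jmax; rewrite /= cardsU1 iJ ltnn.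
rewrite big_setU1//= => c0 /existsNP [j /not_implyP [jiJ cj]].
have ci : c i != 0.
  apply/eqP => ci; move: c0; rewrite ci scale0r add0r => /Jind cJ.
  by apply: cj; move: jiJ; rewrite !inE => /predU1P[->//|/cJ].
exists (fun j => - (c i)^-1 * c j); under eq_bigr do rewrite -scalerA.
rewrite -scaler_sumr; apply: (scalerI ci); rewrite scalerA mulrN mulfV//.
by apply/eqP; rewrite scaleN1r -addr_eq0 c0.
Qed.

Hypothesis faithL : left_faithful.

(** The inequality rank a + rank b <= #|I|, in the form of generating subfamilies
    with complementary index sets: on a maximal independent subfamily of the a's, the
    sum collects into independent terms, whose coefficients therefore vanish, and these
    coefficients express the corresponding b's through the others. *)
Lemma tensor_relation (I : finType) (a b : I -> L) :
  (forall T, \sum_i a i * T * b i = 0) ->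
  exists J : {set I},
    (exists c : I -> I -> F, forall i, a i = \sum_(j in J) c i j *: a j) /\
    (exists c : I -> I -> F, forall i, b i = \sum_(j in ~: J) c i j *: b j).
Proof.
move=> ab; have [J Jind [c cP]] := max_lin_indep a; exists J; split; first by exists c.
have H : forall j, j \in J -> b j + \sum_(i in ~: J) c i j *: b i = 0.
  apply: faithL Jind => T; rewrite -[RHS](ab T) [in RHS](bigID (mem J))/=.
  under eq_bigr do rewrite mulrDr mulr_sumr.
  rewrite big_split/=; congr (_ + _); rewrite exchange_big/=.
  apply: eq_big => [i|i]; rewrite !inE// => _; rewrite [in RHS](cP i) !mulr_suml.
  by apply: eq_bigr => j _; rewrite -scalerAr -!scalerAl.
exists (fun i j => if i \in J then - c j i else (j == i)%:R) => i.
have [iJ|iJ] := boolP (i \in J).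
  have /eqP := H _ iJ; rewrite addr_eq0 => /eqP->.
  by rewrite -sumrN; under [RHS]eq_bigr do rewrite scaleNr.
rewrite (bigD1 i) ?inE//= eqxx scale1r big1 ?addr0//.
by move=> j /andP[_ /negPf->]; rewrite scale0r.
Qed.

Lemma span_card_le2 (I : finType) (J : {set I}) (a : I -> L) : (#|J| <= 2)%N ->
  exists p q, forall c : I -> F, span2 p q (\sum_(j in J) c j *: a j).
Proof.
rewrite cardE; case E: (enum J) => [|i [|j []]]// _.
- by exists 0, 0 => c; exists 0, 0; rewrite -big_enum E big_nil !scaler0 addr0.
- by exists (a i), 0 => c; exists (c i), 0; rewrite -big_enum E big_seq1 !scaler0 addr0.
- by exists (a i), (a j) => c; exists (c i), (c j); rewrite -big_enum E big_cons big_seq1.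
Qed.

(** Of two complementary subsets of a five-element set, one has at most two elements. *)
Lemma five_tensor_span (a b : seq L) : size a = 5%N -> size b = 5%N ->
  (forall T, \sum_(i < 5) a`_i * T * b`_i = 0) ->
  (exists p q, forall x, x \in a -> span2 p q x) \/
  (exists p q, forall x, x \in b -> span2 p q x).
Proof.
move=> sa sb /tensor_relation[J [[c cP] [d dP]]].
have [J2|J3] := leqP #|J| 2; [left|right].
  have [p [q pqP]] := span_card_le2 (fun i : 'I_5 => a`_i) J2.
  exists p, q => x /(nthP 0) [j]; rewrite sa => j5 <-.
  by rewrite (cP (Ordinal j5)); apply: pqP.
have : (#|~: J| <= 2)%N.
  by rewrite -(leq_add2l #|J|) cardsC card_ord -[5%N]/(3 + 2)%N leq_add2r.
move=> /(span_card_le2 (fun i : 'I_5 => b`_i))[p [q pqP]].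
exists p, q => x /(nthP 0) [j]; rewrite sb => j5 <-.
by rewrite (dP (Ordinal j5)); apply: pqP.
Qed.

Let sumT (I : finType) (f : I -> L) : \sum_(i in [set: I]) f i = \sum_i f i.
Proof. by apply: eq_bigl => i; rewrite inE. Qed.

Lemma tensor_eq0 (a b : L) : (forall T, a * T * b = 0) -> a = 0 \/ b = 0.
Proof.
move=> ab; have [->|a0] := eqVneq a 0; [by left|right].
have := @faithL unit [set: unit] (fun=> a) (fun=> b).
move/(_ _ _ tt (finset.in_setT _)); apply=> [T|c].
  by rewrite sumT (big_pred1 tt)// => -[].
rewrite sumT (big_pred1 tt) => [/eqP|[]//].
by rewrite scaler_eq0 (negPf a0) orbF => /eqP c0 [].
Qed.

Lemma tensor_eq (a b c d : L) : (forall T, a * T * b = c * T * d) ->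
  c != 0 -> d != 0 -> exists k, [/\ k != 0, a = k *: c & d = k *: b].
Proof.
move=> abcd c0 d0.
pose x (i : bool) := if i then a else c; pose y (i : bool) := if i then b else - d.
have xy T : \sum_(i in [set: bool]) x i * T * y i = 0.
  by rewrite sumT big_bool /x /y /= abcd mulrN subrr.
have [|/existsNP [s /not_implyP []]] := pselect (lin_indep [set: bool] x).
  move=> /(faithL xy) /(_ false (finset.in_setT _)) /eqP.
  by rewrite oppr_eq0 (negPf d0).
rewrite sumT big_bool /x /= => sac /existsNP [i /not_implyP [_ si]].
have st0 : s true != 0.
  apply/eqP => st; move/eqP: sac; rewrite st scale0r add0r scaler_eq0.
  by rewrite (negPf c0) orbF => /eqP sf; apply: si; case: i.
have ac : a = (- (s false) / s true) *: c.
  apply: (scalerI st0); rewrite scalerA mulrCA mulfV// mulr1 scaleNr.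
  by apply/eqP; rewrite -addr_eq0 sac.
move: ac abcd; set k := _ / _ => ac abcd.
have [| |/eqP] := @tensor_eq0 c (d - k *: b).
- by move=> T; rewrite mulrBr -abcd ac -scalerAr -!scalerAl subrr.
- by move/eqP; rewrite (negPf c0).
rewrite subr_eq0 => /eqP dk; exists k; split=> //.
by apply: contra_neq d0 => k0; rewrite dk k0 scale0r.
Qed.

Lemma tensor_scalarr (a b c : L) : (forall T, a * T * b = c * T) -> a != 0 ->
  exists k : F, b = k%:A /\ c = k *: a.
Proof.
move=> abc a0; have [c0|c0] := eqVneq c 0.
  have [| |->] := @tensor_eq0 a b; first by move=> T; rewrite abc c0 mul0r.
    by move/eqP; rewrite (negPf a0).
  by exists 0; rewrite c0 !scale0r.
have [|//||k [k0 -> ->]] := @tensor_eq a b c 1; first by move=> T; rewrite mulr1.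
  exact: oner_neq0.
have k1 := mulVf k0; exists k^-1; split; last by rewrite scalerA k1 scale1r.
by rewrite scalerA k1 scale1r.
Qed.

Lemma tensor_scalarl (a b w : L) : (forall T, a * T * b = T * w) -> b != 0 ->
  exists k : F, a = k%:A.
Proof.
move=> abw b0; have [w0|w0] := eqVneq w 0.
  have [|->|] := @tensor_eq0 a b; first by move=> T; rewrite abw w0 mulr0.
    by exists 0; rewrite scale0r.
  by move/eqP; rewrite (negPf b0).
have [|||k [_ -> _]] := @tensor_eq a b 1 w => //; first by move=> T; rewrite mul1r.
  exact: oner_neq0.
by exists k.
Qed.

(** If a is nonzero then [tensor_scalarr] makes b a scalar. *)
Lemma tensor_nonscalar (a b c : L) : (forall T, a * T * b = c * T) ->
  (forall k : F, b != k%:A) -> a = 0 /\ c = 0.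
Proof.
move=> abc bN; have [a0|/(tensor_scalarr abc)[k [/eqP]]] := eqVneq a 0.
  by split=> //; rewrite -[c]mulr1 -abc a0 !mul0r.
by rewrite (negPf (bN k)).
Qed.

End Independence.

(** * Quadratic forms and linear relations in two variables *)

Section Pencil.
Variable F : numClosedFieldType.

Lemma quadratic_zero (a b c : F) :
  exists x y, (x != 0) || (y != 0) /\ a * x ^+ 2 + b * x * y + c * y ^+ 2 = 0.
Proof.
have [->|a0] := eqVneq a 0.
  exists 1, 0; rewrite oner_neq0; split=> //; ring.
have a20 : 2 * a != 0 by rewrite mulf_neq0// pnatr_eq0.
exists ((sqrtC (b ^+ 2 - 4 * a * c) - b) / (2 * a)), 1; rewrite oner_neq0 orbT.
split=> //; have := sqrtCK (b ^+ 2 - 4 * a * c); set r := sqrtC _ => rE.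
have -> : c = (b ^+ 2 - r ^+ 2) / (4 * a) by rewrite rE; field.
by field.
Qed.

Lemma singular_left_kernel (a b c d : F) : a * d = b * c ->
  exists u w, (u != 0) || (w != 0) /\ u * a + w * b = 0 /\ u * c + w * d = 0.
Proof.
move=> adbc; have [b0|b0] := eqVneq b 0; last first.
  exists (- b), a; rewrite oppr_eq0 b0; split=> //; split; first by ring.
  by rewrite mulNr adbc addNr.
have [a0|a0] := eqVneq a 0.
  have [d0|d0] := eqVneq d 0.
    by exists 0, 1; rewrite oner_neq0 orbT a0 b0 d0 !mulr0 mul0r !addr0.
  by exists d, (- c); rewrite d0 a0 b0 !mulr0 !addr0; split=> //; split=> //; ring.
exists 0, 1; rewrite oner_neq0 orbT b0 !mul0r !add0r !mul1r; split=> //; split=> //.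
by apply: (mulfI a0); rewrite adbc b0 mul0r mulr0.
Qed.

Variable L : algType F.

Lemma span2_dependent (p q x y z : L) : span2 p q x -> span2 p q y -> span2 p q z ->
  exists k l m : F, [|| k != 0, l != 0 | m != 0] /\ k *: x + l *: y + m *: z = 0.
Proof.
case=> [x1 [x2 ->]] [y1 [y2 ->]] [z1 [z2 ->]].
have lin (k l m : F) : k *: (x1 *: p + x2 *: q) + l *: (y1 *: p + y2 *: q) +
    m *: (z1 *: p + z2 *: q) =
    (k * x1 + l * y1 + m * z1) *: p + (k * x2 + l * y2 + m * z2) *: q.
  by rewrite !scalerDr !scalerA !scalerDl [X in X + _ = _]addrACA [LHS]addrACA.
have [/eqP|mN0] := eqVneq (x1 * y2 - y1 * x2) 0.
  rewrite subr_eq0 => /eqP /singular_left_kernel [k [l [kl [e1 e2]]]].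
  exists k, l, 0; split; first by case/orP: kl => ->; rewrite ?orbT.
  by rewrite lin e1 e2 !mul0r !addr0 !scale0r addr0.
exists (y1 * z2 - z1 * y2), (z1 * x2 - x1 * z2), (x1 * y2 - y1 * x2).
rewrite mN0 !orbT; split=> //; rewrite lin.
set c1 := (X in X *: p); set c2 := (X in X *: q).
have -> : c1 = 0 by rewrite /c1; ring.
have -> : c2 = 0 by rewrite /c2; ring.
by rewrite !scale0r addr0.
Qed.

End Pencil.

(** * Changing the representation of an operator of length two *)

Section Representation.
Variables (F : numClosedFieldType) (L : algType F).

Definition rep (D : L -> L) (A1 B1 A2 B2 : L) :=
  forall T, D T = A1 * T * B1 + A2 * T * B2.

(** Together with a two-term representation of D, this is length two; it makes A1, A2
    independent, and B1, B2 as well, in every such representation. *)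
Definition not_single (D : L -> L) := forall A B, ~ forall T, D T = A * T * B.

Lemma rep_swap D A1 B1 A2 B2 : rep D A1 B1 A2 B2 -> rep D A2 B2 A1 B1.
Proof. by move=> DE T; rewrite DE addrC. Qed.

(** Elementary changes of basis in span(A1, A2), with the dual change on the B's;
    [rep_swap] and [rep_scale] are the others. *)
Lemma rep_shear (k : F) D A1 B1 A2 B2 : rep D A1 B1 A2 B2 ->
  rep D A1 (B1 - k *: B2) (A2 + k *: A1) B2.
Proof.
move=> DE T; rewrite DE mulrBr !mulrDl -!scalerAr -!scalerAl.
by rewrite [A2 * T * B2 + _]addrC addrA subrK.
Qed.

Lemma rep_scale (k : F) D A1 B1 A2 B2 : k != 0 -> rep D A1 B1 A2 B2 ->
  rep D (k *: A1) (k^-1 *: B1) A2 B2.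
Proof.
by move=> k0 DE T; rewrite DE -scalerAr -!scalerAl scalerA mulVf// scale1r.
Qed.

(** Any nonzero combination of A1 and A2 extends to a basis; keeping one of the old
    elements as the second one lets statements about spans pass to the new basis. *)
Lemma rep_basis (x y : F) D A1 B1 A2 B2 : (x != 0) || (y != 0) ->
  rep D A1 B1 A2 B2 -> exists A B1' B2',
  rep D (x *: A1 + y *: A2) B1' A B2' /\ (A = A1 \/ A = A2).
Proof.
have [->/= y0 DE|x0 _ DE] := eqVneq x 0.
  exists A1, (y^-1 *: B2), B1; split; last by left.
  by rewrite scale0r add0r; apply: rep_scale => //; apply: rep_swap.
exists A2, (x^-1 *: B1), (B2 - (y / x) *: B1); split; last by right.
move/rep_swap/(rep_shear (y / x))/rep_swap/(rep_scale x0): DE.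
by rewrite scalerDr scalerA mulrCA mulfV// mulr1.
Qed.

Lemma not_single_neq0 D A1 B1 A2 B2 : not_single D -> rep D A1 B1 A2 B2 ->
  [/\ A1 != 0, B1 != 0, A2 != 0 & B2 != 0].
Proof.
move=> nD DE; split; apply/eqP => E0.
- by apply: (nD A2 B2) => T; rewrite DE E0 !mul0r add0r.
- by apply: (nD A2 B2) => T; rewrite DE E0 mulr0 add0r.
- by apply: (nD A1 B1) => T; rewrite DE E0 !mul0r addr0.
- by apply: (nD A1 B1) => T; rewrite DE E0 mulr0 addr0.
Qed.

Lemma not_single_indepr D A1 B1 A2 B2 (k : F) : not_single D -> rep D A1 B1 A2 B2 ->
  B2 != k *: B1.
Proof.
move=> nD DE; apply/eqP => E; apply: (nD (A1 + k *: A2) B1) => T.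
by rewrite DE E !mulrDl -scalerAr -!scalerAl.
Qed.

Definition tensor0 (a b : L) := forall T, a * T * b = 0.

Definition dichotomy (D G : L -> L) := exists A1 B1 A2 B2 C1 D1 C2 D2,
  rep D A1 B1 A2 B2 /\ rep G C1 D1 C2 D2 /\
  ([/\ is_unit A1, is_unit B1, is_unit A2 & is_unit B2] \/
   [/\ tensor0 (C1 * A2) (B2 * D1), tensor0 (A2 * C1) (D1 * B2),
       tensor0 (C2 * A1) (B1 * D2) & tensor0 (A1 * C2) (D2 * B1)]).

Section Inverse.
Hypothesis faithL : left_faithful L.
Variables D G : L -> L.
Hypothesis DK : cancel D G.
Hypothesis GK : cancel G D.
Hypothesis nD : not_single D.
Hypothesis nG : not_single G.

Lemma rep_annihilr A1 B1 A2 B2 C : rep D A1 B1 A2 B2 ->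
  A1 * C = 0 -> A2 * C = 0 -> C = 0.
Proof.
move=> DE e1 e2; have D0 : D 0 = 0 by rewrite DE !mulr0 !mul0r addr0.
by rewrite -(DK C) DE e1 e2 !mul0r addr0 -{1}D0 DK.
Qed.

Lemma rep_annihill C1 D1 C2 D2 A : rep G C1 D1 C2 D2 ->
  A * C1 = 0 -> A * C2 = 0 -> A = 0.
Proof.
move=> GE e1 e2; rewrite -(mulr1 A) -(DK 1) GE mulrDr !mulrA e1 e2.
by rewrite !mul0r addr0.
Qed.

Section Identities.
Variables A1 B1 A2 B2 C1 D1 C2 D2 : L.
Hypotheses (DE : rep D A1 B1 A2 B2) (GE : rep G C1 D1 C2 D2).

Lemma rep_DG T : A1 * C1 * T * (D1 * B1) + A1 * C2 * T * (D2 * B1) +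
  (A2 * C1 * T * (D1 * B2) + A2 * C2 * T * (D2 * B2)) = T.
Proof. by rewrite -[RHS]GK DE GE !mulrDr !mulrDl !mulrA. Qed.

Lemma rep_GD T : C1 * A1 * T * (B1 * D1) + C1 * A2 * T * (B2 * D1) +
  (C2 * A1 * T * (B1 * D2) + C2 * A2 * T * (B2 * D2)) = T.
Proof. by rewrite -[RHS]DK GE DE !mulrDr !mulrDl !mulrA. Qed.

End Identities.

(** A zero divisor x A1 + y A2, z C1 + w C2 is found by solving for (z, w) first: the
    coordinates in p, q of A1 (z C1 + w C2) and A2 (z C1 + w C2) form a 2 x 2 matrix
    whose determinant is a quadratic form in (z, w); at a zero of this form the matrix
    has a left kernel vector (x, y).  Afterwards the three remaining products lie in the
    span of p and q, hence satisfy k A1 C1 + l A2 C1 + m A2 C2 = 0.  For l != 0 the left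
    side factors, up to A1 C2 = 0, as (A2 + (k/l) A1)(C1 + (m/l) C2); for l = 0,
    invertibility forces k and m to be nonzero. *)
Lemma normal_form (p q : L) A1 B1 A2 B2 C1 D1 C2 D2 :
  rep D A1 B1 A2 B2 -> rep G C1 D1 C2 D2 ->
  span2 p q (A1 * C1) -> span2 p q (A1 * C2) ->
  span2 p q (A2 * C1) -> span2 p q (A2 * C2) ->
  exists A1 B1 A2 B2 C1 D1 C2 D2, [/\ rep D A1 B1 A2 B2, rep G C1 D1 C2 D2,
    A1 * C2 = 0 & A2 * C1 = 0 \/ A1 * C1 = - (A2 * C2)].
Proof.
move=> DE GE s11 s12 s21 s22.
have [A [B [A' [B' [C [E [C' [E' [[{}DE {}GE] [AC s1 s2 s3]]]]]]]]]] :
    exists A B A' B' C E C' E', (rep D A B A' B' /\ rep G C E C' E') /\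
    [/\ A * C' = 0, span2 p q (A * C), span2 p q (A' * C) & span2 p q (A' * C')].
  have mulD (x y z w : F) X Y Z W : (x *: X + y *: Y) * (z *: Z + w *: W) =
      x *: (z *: (X * Z) + w *: (X * W)) + y *: (z *: (Y * Z) + w *: (Y * W)) :> L.
    by rewrite mulrDl !mulrDr -!scalerAl -!scalerAr !scalerDr.
  have spanD (x y : F) X Y : span2 p q X -> span2 p q Y -> span2 p q (x *: X + y *: Y).
    move=> [a [b ->]] [c [d ->]]; exists (x * a + y * c), (x * b + y * d).
    by rewrite !scalerDr !scalerA !scalerDl addrACA.
  have [m11 [n11 e11]] := s11; have [m12 [n12 e12]] := s12.
  have [m21 [n21 e21]] := s21; have [m22 [n22 e22]] := s22.
  have [z [w [zw quad]]] := quadratic_zero (m11 * n21 - m21 * n11)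
    (m11 * n22 + m12 * n21 - m21 * n12 - m22 * n11) (m12 * n22 - m22 * n12).
  have [|x [y [xy [e e']]]] := @singular_left_kernel F (z * m11 + w * m12)
    (z * m21 + w * m22) (z * n11 + w * n12) (z * n21 + w * n22).
    apply/eqP; rewrite -subr_eq0 -[X in _ == X]quad; apply/eqP; ring.
  have [A [B [B' [DE' AE]]]] := rep_basis xy DE.
  have [C [E [E' [GE' CE]]]] := rep_basis zw GE.
  exists (x *: A1 + y *: A2), B, A, B', C, E', (z *: C1 + w *: C2), E.
  split; [by split=> //; exact: rep_swap | split].
  - rewrite mulD e11 e12 e21 e22 !scalerDr !scalerA.
    rewrite [X in X + _ = _]addrACA [X in _ + X = _]addrACA [LHS]addrACA -!scalerDl.
    set c1 := (X in X *: p); set c2 := (X in X *: q).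
    have -> : c1 = 0 by rewrite /c1 -[RHS]e; ring.
    have -> : c2 = 0 by rewrite /c2 -[RHS]e'; ring.
    by rewrite !scale0r addr0.
  - by rewrite mulrDl -!scalerAl; case: CE => ->; apply: spanD.
  - by case: AE => ->; case: CE => ->.
  - by rewrite mulrDr -!scalerAr; case: AE => ->; apply: spanD.
have [k [l [m [klm rel]]]] := span2_dependent s1 s2 s3.
have [l0|l0] := eqVneq l 0; last first.
  exists A, (B - (k / l) *: B'), (A' + (k / l) *: A), B'.
  exists (C + (m / l) *: C'), E, C', (E' - (m / l) *: E).
  split=> //; [exact: rep_shear | exact/rep_swap/rep_shear/rep_swap | left].
  apply: (scalerI l0); rewrite scaler0 -[RHS]rel.
  rewrite !mulrDl !mulrDr -!scalerAl -!scalerAr AC !scaler0 addr0.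
  by rewrite !scalerDr !scalerA ![l * _]mulrC !divfK// addrAC [k *: _ + _]addrC.
have [A0 _ _ _] := not_single_neq0 nD DE.
have [_ _ C0 _] := not_single_neq0 nG GE.
move: rel klm; rewrite l0 scale0r addr0 eqxx /= => rel klm.
have k0 : k != 0.
  apply/eqP => k0; move: rel klm; rewrite k0 eqxx scale0r add0r /= => /eqP + m0.
  rewrite scaler_eq0 (negPf m0)/= => /eqP AC'.
  by move/eqP: C0; apply; apply: rep_annihilr DE AC AC'.
have m0 : m != 0.
  apply/eqP => m0; move: rel; rewrite m0 scale0r addr0 => /eqP.
  rewrite scaler_eq0 (negPf k0)/= => /eqP AC'.
  by move/eqP: A0; apply; apply: rep_annihill GE AC' AC.
have mk0 : m / k != 0 by rewrite mulf_neq0 ?invr_eq0.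
exists A, B, ((m / k) *: A'), ((m / k)^-1 *: B'), C, E, C', E'.
split=> //; [exact/rep_swap/rep_scale/rep_swap | right].
apply: (scalerI k0); rewrite scalerN -scalerAl scalerA mulrCA mulfV// mulr1.
by apply/eqP; rewrite -addr_eq0 rel.
Qed.

Lemma tensor0P (a b : L) : tensor0 a b <-> a = 0 \/ b = 0.
Proof.
split; first exact: tensor_eq0.
by case=> -> T; rewrite ?mul0r ?mulr0.
Qed.

Lemma tensor_eq_id (a b c : L) : (forall T, a * T * b = c * T) -> c != 0 ->
  exists k : F, [/\ k != 0, a = k *: c & b = k^-1%:A].
Proof.
move=> abc c0; have [T|k [k0 ac b1]] := @tensor_eq _ _ faithL a b c 1 _ c0 (oner_neq0 _).
  by rewrite abc mulr1.
by exists k; split=> //; rewrite b1 scalerA mulVf// scale1r.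
Qed.

(** Put M_i = A_i (x) B_i and G_j = C_j (x) D_j, so that M_1 G_2 = M_2 G_1 = 0.
    Then D G_1 = M_1 G_1 = M_1 G, whence G_1 D = G M_1, that is G_1 M_2 = G_2 M_1.  It
    remains to see that this common value C1 A2 (x) B2 D1 vanishes.  Otherwise
    multiplying it by A1 and A2 gives A1 C1 A2 = 0 and A2 C2 A1 = 0; then B1 D1, D1 B1
    and B2 D2 are nonzero scalars, and GD = 1 reads
      (scalar combination of C1 A1, C2 A2 and 1) (x) 1 + 2 C1 A2 (x) B2 D1 = 0,
    so B2 D1 is a scalar, which makes B2 a multiple of B1. *)
Lemma orthogonal_case A1 B1 A2 B2 C1 D1 C2 D2 :
  rep D A1 B1 A2 B2 -> rep G C1 D1 C2 D2 ->
  A1 * C2 = 0 -> A2 * C1 = 0 -> dichotomy D G.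
Proof.
move=> DE GE A1C2 A2C1.
have [A10 B10 A20 B20] := not_single_neq0 nD DE.
have cross T : C1 * A2 * T * (B2 * D1) = C2 * A1 * T * (B1 * D2).
  have e S : D (C1 * S * D1) = A1 * G S * B1.
    by rewrite DE GE mulrDr mulrDl !mulrA A2C1 A1C2 !mul0r !addr0.
  have := DK (C1 * D T * D1); rewrite e DK GE DE.
  rewrite !mulrDr !mulrDl !mulrA => /addrI/esym; exact.
suff : C1 * A2 = 0 \/ B2 * D1 = 0.
  move/tensor0P => z; exists A1, B1, A2, B2, C1, D1, C2, D2.
  split=> //; split=> //; right; split=> // T; last by rewrite A1C2 !mul0r.
    by rewrite A2C1 !mul0r.
  by rewrite -cross z.
have [|CA0] := eqVneq (C1 * A2) 0; first by left.
have [|BD0] := eqVneq (B2 * D1) 0; first by right.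
have BD0' : B1 * D2 != 0.
  apply/eqP => z; have /tensor0P[] : tensor0 (C1 * A2) (B2 * D1).
  - by move=> T; rewrite cross z mulr0.
  - by move/eqP; rewrite (negPf CA0).
  - by move/eqP; rewrite (negPf BD0).
have PA2 : A1 * C1 * A2 = 0.
  have /tensor0P[//|/eqP] : tensor0 (A1 * C1 * A2) (B2 * D1).
    by move=> T; rewrite -!(mulrA A1) cross !mulrA A1C2 !mul0r.
  by rewrite (negPf BD0).
have QA1 : A2 * C2 * A1 = 0.
  have /tensor0P[//|/eqP] : tensor0 (A2 * C2 * A1) (B1 * D2).
    by move=> T; rewrite -!(mulrA A2) -cross !mulrA A2C1 !mul0r.
  by rewrite (negPf BD0').
have DG := rep_DG DE GE; have GD := rep_GD DE GE.
have [|//|k [k0 PA1 BD1]] := @tensor_eq_id (A1 * C1 * A1) (B1 * D1) A1.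
  by move=> T; rewrite -[in RHS](GD T) !mulrDr !mulrA A1C2 PA2 !mul0r !addr0.
have [|//|l [l0 QA2 BD2]] := @tensor_eq_id (A2 * C2 * A2) (B2 * D2) A2.
  by move=> T; rewrite -[in RHS](GD T) !mulrDr !mulrA A2C1 QA1 !mul0r !add0r.
have DB1 : k *: (D1 * B1) = 1.
  apply/eqP; rewrite -subr_eq0; apply/eqP.
  have [|/eqP|//] := @tensor_eq0 _ _ faithL A1 (k *: (D1 * B1) - 1).
    move=> T; rewrite mulrBr mulr1 -scalerAr !scalerAl -PA1.
    rewrite -[X in _ - X]DG !mulrA A1C2 A2C1 QA1 !mul0r !addr0 -!mulrA.
    by rewrite subrr.
  by rewrite (negPf A10).
have [||/eqP] := @tensor_nonscalar _ _ faithL (2 *: (C1 * A2)) (B2 * D1)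
  (1 - k^-1 *: (C1 * A1) - l^-1 *: (C2 * A2)).
- move=> T; rewrite !mulrBl mul1r -[X in X - _ - _](GD T) -cross BD1 BD2.
  rewrite -!scalerAr !mulr1 -!scalerAl [k^-1 *: _ + _]addrC addrACA.
  by rewrite -[RHS]addrA -opprD addrK -mulr2n scaler_nat.
- move=> s; apply/negP => /eqP BDs; have /eqP[] := not_single_indepr (k * s) nD DE.
  by rewrite -[LHS]mulr1 -DB1 -scalerAr mulrA BDs mulr_algl scalerA.
- by rewrite scaler_eq0 pnatr_eq0 (negPf CA0).
Qed.

Lemma not_single_indepl A1 B1 A2 B2 (k : F) E : not_single E -> rep E A1 B1 A2 B2 ->
  B1 != k *: B2.
Proof. by move=> nE /rep_swap; apply: not_single_indepr. Qed.

Lemma is_unitM (a b : L) : is_unit a -> is_unit b -> is_unit (a * b).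
Proof.
move=> [a' [aa' a'a]] [b' [bb' b'b]]; exists (b' * a'); split.
  by rewrite mulrA -(mulrA a) bb' mulr1.
by rewrite mulrA -(mulrA b') a'a mulr1.
Qed.

Lemma is_unitZ (k : F) (a : L) : k != 0 -> is_unit a -> is_unit (k *: a).
Proof.
move=> k0 [a' [aa' a'a]]; exists (k^-1 *: a').
by rewrite -!scalerAl -!scalerAr !scalerA mulfV// mulVf// !scale1r.
Qed.

Lemma is_unit1D_square0 (P : L) : P * P = 0 -> is_unit (1 + P).
Proof.
move=> P2; exists (1 - P); split.
  by rewrite mulrDl mul1r mulrBr mulr1 P2 subr0 subrK.
by rewrite mulrBl mul1r mulrDr mulr1 P2 addr0 addrK.
Qed.

Hypothesis shift_unit : forall U : L, exists2 t : F, t != 0 &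
  is_unit (t%:A + U) /\ is_unit (t%:A - U).

(** With a = A2 + t A1 and a' = A2 - t A1, the operator D equals
    (2t)^-1 (a (x) (B1 + t B2) + a' (x) (t B2 - B1)).  Here a and a' are invertible for
    every t because 1 + t P and 1 - t P are mutually inverse, and the choice of t makes
    (B1 + t B2) B2^-1 and (t B2 - B1) B2^-1 invertible. *)
Lemma unit_case A1 B1 A2 B2 C1 D1 C2 D2 P :
  rep D A1 B1 A2 B2 -> rep G C1 D1 C2 D2 ->
  is_unit A2 -> is_unit B2 -> A1 = P * A2 -> P * P = 0 -> dichotomy D G.
Proof.
move=> DE GE A2u [B' [B2B' B'B2]] A1E P2.
have [t t0 [up um]] := shift_unit (B1 * B').
have t20 : 2 * t != 0 by rewrite mulf_neq0// pnatr_eq0.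
have uP s : is_unit (A2 + s *: A1).
  rewrite A1E -{1}[A2]mul1r scalerAl -mulrDl; apply: is_unitM => //.
  by apply: is_unit1D_square0; rewrite -scalerAl -scalerAr P2 !scaler0.
have uB : is_unit B2 by exists B'.
exists (A1 + (2 * t)^-1 *: (A2 - t *: A1)), (B1 + t *: B2).
exists (A2 - t *: A1), (B2 - (2 * t)^-1 *: (B1 + t *: B2)).
exists C1, D1, C2, D2; split; [|split=> //; left; split].
- have := rep_swap (rep_shear (2 * t)^-1 (rep_swap (rep_shear (- t) DE))).
  by rewrite !scaleNr opprK.
- rewrite (_ : A1 + _ = (2 * t)^-1 *: (A2 + t *: A1)).
    by apply: is_unitZ; rewrite ?invr_eq0.
  apply: (scalerI t20); rewrite scalerDr !scalerA mulfV// !scale1r.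
  by rewrite mulr_natl mulr2n scalerDl addrC addrA subrK.
- have -> : B1 + t *: B2 = (t%:A + B1 * B') * B2.
    by rewrite mulrDl -mulrA B'B2 mulr1 mulr_algl addrC.
  exact: is_unitM.
- by rewrite -scaleNr.
- have -> : B2 - (2 * t)^-1 *: (B1 + t *: B2) = (2 * t)^-1 *: ((t%:A - B1 * B') * B2).
    apply: (scalerI t20); rewrite scalerBr !scalerA mulfV// !scale1r.
    rewrite mulrBl -mulrA B'B2 mulr1 mulr_algl.
    by rewrite mulr_natl mulr2n scalerDl opprD addrACA subrr addr0.
  by apply: is_unitZ; rewrite ?invr_eq0//; apply: is_unitM.
Qed.

(** Let P = A1 C1 = - A2 C2 and Q = A2 C1.  Multiplying GD = 1 by A1 on the left
    ([eA]) and then by C2 on the right gives P^2 (x) B2 D1 = 0.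

    If B2 D1 = 0, then B1 D1, B2 D2, P and Q turn out to be scalars, with P nonzero, and
    subtracting a multiple of A1 from A2 achieves A2 C1 = 0: the orthogonal case.

    If P^2 = 0, the same identities show that B2 and D1 are inverse up to a scalar k,
    that A1 = k^-1 P A2 and C2 = - k^-1 C1 P, and that 1 - k^-1 Q = a P for some scalar
    a; substituting these in GD = 1 gives k^-1 (C1 + a C1 P) as the inverse of A2. *)
Lemma tangent_case A1 B1 A2 B2 C1 D1 C2 D2 :
  rep D A1 B1 A2 B2 -> rep G C1 D1 C2 D2 ->
  A1 * C2 = 0 -> A1 * C1 = - (A2 * C2) -> dichotomy D G.
Proof.
move=> DE GE A1C2 PE.
have [A10 B10 A20 B20] := not_single_neq0 nD DE.
have [C10 D10 C20 D20] := not_single_neq0 nG GE.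
have DG := rep_DG DE GE; have GD := rep_GD DE GE.
have [P A1C1] : exists P, A1 * C1 = P by exists (A1 * C1).
have [Q A2C1] : exists Q, A2 * C1 = Q by exists (A2 * C1).
have A2C2 : A2 * C2 = - P by rewrite -A1C1 PE opprK.
have P0 : P != 0.
  by apply/eqP => z; move/eqP: A10; apply; apply: rep_annihill GE _ A1C2; rewrite A1C1.
have eA T : A1 * T = P * A1 * T * (B1 * D1) + P * A2 * T * (B2 * D1).
  by rewrite -[in LHS](GD T) !mulrDr !mulrA A1C1 A1C2 !mul0r !addr0.
have eC T : C2 * T = - (C1 * P) * T * (B2 * D1) - C2 * P * T * (B2 * D2).
  rewrite -[LHS](GD (C2 * T)) !mulrA -!(mulrA _ _ C2) A1C2 A2C2.
  by rewrite !(mulrN, mulNr, mulr0, mul0r) !add0r.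
have PPBD : P * P = 0 \/ B2 * D1 = 0.
  apply/tensor0P => T; apply/eqP; rewrite -oppr_eq0; apply/eqP.
  rewrite !mulrA; have := eA (C2 * T); rewrite !mulrA -!(mulrA _ _ C2) A1C2 A2C2.
  by rewrite !(mulrN, mulNr, mulr0, mul0r) add0r => <-.
have eDG T : P * T * (D1 * B1 - D2 * B2) + Q * T * (D1 * B2) = T.
  rewrite -[RHS]DG A1C1 A1C2 A2C1 A2C2 !mul0r addr0 mulrBr !mulNr.
  by rewrite -[LHS]addrA [- _ + _]addrC.
have [BD0|BD0] := eqVneq (B2 * D1) 0.
  have [|//|p [p0 PA1 BD1]] := @tensor_eq_id (P * A1) (B1 * D1) A1.
    by move=> T; rewrite (eA T) BD0 mulr0 addr0.
  have [|//|l [l0 _ BD2]] := @tensor_eq_id (- (C2 * P)) (B2 * D2) C2.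
    by move=> T; rewrite (eC T) BD0 !mulr0 add0r !mulNr.
  have {}PE : P = (- l)%:A.
    apply: (scalerI (invr_neq0 l0)); rewrite scalerA mulrN mulVf// scaleN1r.
    apply/eqP; rewrite -addr_eq0; apply/eqP.
    have [T||/eqP] := @tensor_eq0 _ _ faithL (l^-1 *: P + 1) B2; last 2 first.
    - by [].
    - by rewrite (negPf B20).
    have e : T * B2 = - (l^-1 *: (P * T * B2)).
      rewrite -[LHS](eDG (T * B2)) mulrBr !mulrA -!(mulrA _ B2) BD0 BD2.
      by rewrite !(mulr0, mul0r) sub0r addr0 -scalerAr mulr1 -scalerAl.
    by rewrite mulrDl mul1r mulrDl [X in _ + X]e -!scalerAl addrN.
  (* As Q (x) D1 B2 = 1 (x) w for some w, this makes Q a scalar. *)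
  have DB0 : D1 * B2 != 0.
    apply/eqP => z; move/eqP: B20; apply; apply: (scalerI (invr_neq0 p0)).
    by rewrite scaler0 -mulr_algl -BD1 -mulrA z mulr0.
  have [|q QE] := @tensor_scalarl _ _ faithL Q (D1 * B2) (1 - (- l) *: (D1 * B1 - D2 * B2)) _ DB0.
    by move=> T; rewrite mulrBr mulr1 -scalerAr -{2}(eDG T) PE mulr_algl scalerAl addrC addKr.
  apply: (orthogonal_case (rep_shear (q / l) DE) GE A1C2).
  by rewrite mulrDl -scalerAl A2C1 A1C1 QE PE scalerA mulrN divfK// scaleNr subrr.
case: PPBD => [PP|/eqP]; last by rewrite (negPf BD0).
have [|//|k [k0 PQ BD]] := @tensor_eq_id (P * Q) (B2 * D1) P.
  move=> T; have := eA (C1 * T); rewrite !mulrA A1C1 -[P * A2 * C1]mulrA A2C1.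
  by rewrite -[P * A1 * C1]mulrA A1C1 PP !mul0r add0r.
have DB : D1 * B2 = k^-1%:A.
  apply: (scalerI k0); rewrite scalerA mulfV// scale1r.
  apply/eqP; rewrite -subr_eq0; apply/eqP.
  have [|/eqP|//] := @tensor_eq0 _ _ faithL P (k *: (D1 * B2) - 1); last by rewrite (negPf P0).
  move=> T; rewrite mulrBr mulr1 -[X in _ - P * X](eDG T) mulrDr !mulrA PP PQ.
  by rewrite !mul0r add0r -!mulrA -!scalerAl -!scalerAr subrr.
have kDB : k *: (D1 * B2) = 1 by rewrite DB scalerA mulfV// scale1r.
have kBD : k *: (B2 * D1) = 1 by rewrite BD scalerA mulfV// scale1r.
have [|s|PA1 A1E] := @tensor_nonscalar _ _ faithL (P * A1) (B1 * D1) (A1 - k^-1 *: (P * A2)).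
- by move=> T; rewrite mulrBl (eA T) BD -scalerAr mulr1 -scalerAl addrK.
- apply/negP => /eqP BDs; have /eqP[] := not_single_indepl (k * s) nD DE.
  by rewrite -[LHS]mulr1 -kDB -scalerAr mulrA BDs mulr_algl scalerA.
move/eqP: A1E; rewrite subr_eq0 => /eqP A1E.
have [|s|C2P C2E] := @tensor_nonscalar _ _ faithL (- (C2 * P)) (B2 * D2) (C2 + k^-1 *: (C1 * P)).
- move=> T; rewrite mulrDl (eC T) BD -scalerAr mulr1 -scalerAl !mulNr scalerN.
  by rewrite addrAC addNr add0r.
- apply/negP => /eqP BDs; have /eqP[] := not_single_indepr (k * s) nG GE.
  by rewrite -[LHS]mul1r -kDB -scalerAl -mulrA BDs -scalerAr mulr1 scalerA.
move/eqP: C2E; rewrite addr_eq0 => /eqP C2E.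
have [|a [DBa Qa]] := @tensor_scalarr _ _ faithL P (D1 * B1 - D2 * B2) (1 - k^-1 *: Q) _ P0.
  by move=> T; rewrite mulrBl mul1r -[X in _ = X - _](eDG T) DB -scalerAr mulr1 -scalerAl addrK.
(* Conjugation by B2, whose inverse is k D1, turns D1 B1 - D2 B2 into B1 D1 - B2 D2. *)
have BDa : B1 * D1 - B2 * D2 = a%:A.
  apply: (scalerI (invr_neq0 k0)); have := congr1 (fun Z => B2 * Z * D1) DBa.
  rewrite mulrBr mulrBl !mulrA BD -(mulrA (B2 * D2)) BD -!scalerAr -!scalerAl.
  by rewrite !mul1r !mulr1 BD -scalerBr => ->; rewrite !scalerA mulrC.
have C1A1 : C1 * A1 = k^-1 *: (C1 * P * A2) by rewrite A1E -scalerAr mulrA.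
have C2A1 : C2 * A1 = 0.
  by rewrite C2E mulNr -scalerAl -mulrA PA1 mulr0 scaler0 oppr0.
have C1A2 : k^-1 *: (C1 * A2 + a *: (C1 * P * A2)) = 1.
  rewrite -[RHS](GD 1) !mulr1 C1A1 C2A1 mul0r add0r BD C2E !mulNr -!scalerAl.
  by rewrite addrAC -scalerBr -mulrBr BDa -!scalerAr !mulr1 scalerDr addrC.
apply: (@unit_case _ _ _ _ _ _ _ _ (k^-1 *: P) DE GE).
- exists (k^-1 *: (C1 + a *: (C1 * P))); split.
    have {}Qa : k^-1 *: Q = 1 - a *: P by rewrite -Qa opprB addrC subrK.
    rewrite -scalerAr mulrDr -scalerAr mulrA A2C1 scalerDr scalerA [_ * a]mulrC.
    rewrite -scalerA [k^-1 *: (Q * P)]scalerAl Qa mulrBl mul1r -scalerAl PP.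
    by rewrite scaler0 subr0 subrK.
  by rewrite -scalerAl mulrDl -scalerAl.
- by exists (k *: D1); rewrite -scalerAr -scalerAl.
- by rewrite -scalerAl.
- by rewrite -scalerAl -scalerAr PP !scaler0.
Qed.

Lemma span_case A1 B1 A2 B2 C1 D1 C2 D2 (p q : L) :
  rep D A1 B1 A2 B2 -> rep G C1 D1 C2 D2 ->
  span2 p q (A1 * C1) -> span2 p q (A1 * C2) ->
  span2 p q (A2 * C1) -> span2 p q (A2 * C2) -> dichotomy D G.
Proof.
move=> DE GE s11 s12 s21 s22.
have [A [B [A' [B' [C [E [C' [E' [{}DE {}GE AC [AC'|AC']]]]]]]]]] :=
  normal_form DE GE s11 s12 s21 s22.
- exact: orthogonal_case DE GE AC AC'.
- exact: tangent_case DE GE AC AC'.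
Qed.

End Inverse.
End Representation.

(** * Reduction to a plane of products, on either side *)

Section TwoSided.
Variables (F : numClosedFieldType) (L : algType F).
Hypothesis faithL : left_faithful L.
Hypothesis faithR : left_faithful L^c.
Hypothesis shift_unit : forall U : L, exists2 t : F, t != 0 &
  is_unit (t%:A + U) /\ is_unit (t%:A - U).

Lemma is_unit_converse (a : L) : @is_unit F L^c a <-> is_unit a.
Proof. by split=> -[b [ab ba]]; exists b. Qed.

Lemma rep_converse (D : L -> L) A1 B1 A2 B2 :
  @rep F L^c D B1 A1 B2 A2 <-> rep D A1 B1 A2 B2.
Proof.
by split=> DE T; rewrite DE; congr (_ + _);
  do [exact: (@mulrA L) | exact: esym (@mulrA L _ _ _)].
Qed.

Theorem inverse_dichotomy (D G : L -> L) A1 B1 A2 B2 C1 D1 C2 D2 :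
  rep D A1 B1 A2 B2 -> rep G C1 D1 C2 D2 -> cancel D G -> cancel G D ->
  not_single D -> not_single G -> dichotomy D G.
Proof.
move=> DE GE DK GK nD nG.
(* The identity DG = 1 as a vanishing sum of five simple tensors. *)
pose a := [:: A1 * C1; A1 * C2; A2 * C1; A2 * C2; -1].
pose b := [:: D1 * B1; D2 * B1; D1 * B2; D2 * B2; 1].
have [//|//|T|[p [q pq]]|[p [q pq]]] := @five_tensor_span _ _ faithL a b.
- rewrite !big_ord_recl big_ord0 /= addr0 mulN1r mulr1.
  by rewrite !addrA -[X in _ - X](rep_DG GK DE GE T) !addrA subrr.
- by apply: (@span_case _ _ faithL D G DK GK nD nG shift_unit _ _ _ _ _ _ _ _ p q DE GE);
    apply: pq; rewrite !inE eqxx ?orbT.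
have not_single_converse (E : L -> L) : not_single E -> @not_single F L^c E.
  move=> nE A B EE; apply: (nE B A) => T; rewrite EE.
  exact: (@mulrA L B T A).
have shift_unit_converse (U : L^c) : exists2 t : F, t != 0 &
    @is_unit F L^c (t%:A + U) /\ @is_unit F L^c (t%:A - U).
  have [t t0 [/is_unit_converse up /is_unit_converse um]] := shift_unit U.
  by exists t.
have [] := @span_case _ L^c faithR D G DK GK (not_single_converse _ nD)
  (not_single_converse _ nG) shift_unit_converse _ _ _ _ _ _ _ _ p q
  (iffRL (rep_converse D A1 B1 A2 B2) DE) (iffRL (rep_converse G C1 D1 C2 D2) GE).
1-4: by apply: pq; rewrite !inE eqxx ?orbT.
move=> b1 [a1 [b2 [a2 [d1 [c1 [d2 [c2 [/rep_converse{}DE [/rep_converse{}GE H]]]]]]]]].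
exists a1, b1, a2, b2, c1, d1, c2, d2; split=> //; split=> //.
case: H => [[b1u a1u b2u a2u]|[t1 t2 t3 t4]]; [left|right].
  by split; apply/is_unit_converse.
split=> T; rewrite -[LHS]mulrA; [exact: t1|exact: t2|exact: t3|exact: t4].
Qed.

End TwoSided.

Local Open Scope classical_set_scope.

(** * Bounded functionals separate points *)

Section HahnBanach.
Variables (R : realType) (V : normedModType R[i]).

Definition rnorm (x : V) : R := complex.Re `|x|.

Lemma rnormE x : (rnorm x)%:C%C = `|x|.
Proof. by rewrite /rnorm RRe_real// normr_real. Qed.

Lemma rnormD x y : rnorm (x + y) <= rnorm x + rnorm y.
Proof. by rewrite -lecR rmorphD/= !rnormE ler_normD. Qed.

Lemma rnormZ (c : R) x : rnorm (c%:C%C *: x) = `|c| * rnorm x.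
Proof. by apply: complexI; rewrite rmorphM/= !rnormE normrZ normc_def/= expr0n addr0 sqrtr_sqr. Qed.

Lemma rnorm0 : rnorm 0 = 0.
Proof. by rewrite /rnorm normr0. Qed.

(** Graphs of real-linear functionals on real subspaces, dominated by the norm.  That
    they are single-valued follows from domination, as (0, r) in G forces r <= 0 and
    - r <= 0. *)
Definition dominated_graph (G : set (V * R)) :=
  [/\ forall x r y s, G (x, r) -> G (y, s) -> G (x + y, r + s),
      forall (c : R) x r, G (x, r) -> G (c%:C%C *: x, c * r) &
      forall x r, G (x, r) -> r <= rnorm x].

(** One-dimensional extension: any value c at v with
    r - |x - v| <= c <= |y + v| - s for all (x, r), (y, s) in G will do, and such a c
    exists because r + s <= |x + y| <= |x - v| + |y + v|. *)
Lemma dominated_graph_extend (G : set (V * R)) v : dominated_graph G -> G !=set0 ->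
  exists G', [/\ dominated_graph G', G `<=` G' & exists r, G' (v, r)].
Proof.
move=> [GD GZ Gle] [[x0 r0] G0].
have G00 : G (0, 0) by have := GZ 0 _ _ G0; rewrite mul0r rmorph0 scale0r.
pose S := [set z.2 - rnorm (z.1 - v) | z in G].
have Sub y s : G (y, s) -> ubound S (rnorm (y + v) - s).
  move=> Gys _ [[x r] Gxr <-] /=; rewrite lerBrDr addrAC lerBlDr.
  apply: le_trans (Gle _ _ (GD _ _ _ _ Gxr Gys)) _.
  have -> : x + y = x - v + (y + v) by rewrite addrACA addNr addr0.
  by rewrite [leRHS]addrC rnormD.
have supS : has_sup S.
  by split; [exists (r0 - rnorm (x0 - v)), (x0, r0) | exists (rnorm (0 + v) - 0); apply: Sub].
pose c := sup S.
have cge x r : G (x, r) -> r - rnorm (x - v) <= c.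
  by move=> Gxr; apply: sup_upper_bound => //; exists (x, r).
have cle y s : G (y, s) -> c <= rnorm (y + v) - s.
  by move=> Gys; apply: ge_sup; [case: supS | apply: Sub].
exists [set z | exists x r t, [/\ G (x, r), z.1 = x + t%:C%C *: v & z.2 = r + t * c]].
split; first split.
- move=> _ _ _ _ [x [r [t [Gxr /= -> ->]]]] [y [s [u [Gys /= -> ->]]]].
  exists (x + y), (r + s), (t + u); split; first exact: GD.
    by rewrite rmorphD/= scalerDl addrACA.
  by rewrite mulrDl addrACA.
- move=> a _ _ [x [r [t [Gxr /= -> ->]]]]; exists (a%:C%C *: x), (a * r), (a * t).
  split; first exact: GZ.
    by rewrite scalerDr scalerA rmorphM.
  by rewrite mulrDr mulrA.
- move=> _ _ [x [r [t [Gxr /= -> ->]]]]; have [t0|t0|->] := ltgtP t 0; last first.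
  + by rewrite rmorph0 scale0r mul0r !addr0 Gle.
  + have /cle := GZ t^-1 _ _ Gxr; rewrite -(ler_pM2l t0) mulrBr mulrA mulfV ?gt_eqF// mul1r.
    rewrite lerBrDr addrC => /le_trans; apply.
    rewrite -{1}(gtr0_norm t0) -rnormZ scalerDr scalerA -rmorphM/= mulfV ?gt_eqF//.
    by rewrite scale1r.
  + have nt0 : 0 < - t by rewrite oppr_gt0.
    have /cge := GZ (- t)^-1 _ _ Gxr; rewrite -(ler_pM2l nt0) mulrBr mulrA mulfV ?gt_eqF// mul1r.
    rewrite lerBlDr mulNr addrC -lerBlDr opprK => /le_trans; apply.
    rewrite -{1}(gtr0_norm nt0) -rnormZ scalerBr scalerA -rmorphM/= mulfV ?gt_eqF//.
    by rewrite scale1r rmorphN scaleNr opprK.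
- by move=> [x r] Gxr; exists x, r, 0; rewrite rmorph0 scale0r mul0r !addr0.
- by exists c, 0, 0, 1; rewrite rmorph1 scale1r mul1r !add0r.
Qed.

Lemma real_norming_functional (x0 : V) : exists f : V -> R,
  [/\ forall x y, f (x + y) = f x + f y, forall (c : R) x, f (c%:C%C *: x) = c * f x,
      forall x, f x <= rnorm x & f x0 = rnorm x0].
Proof.
(* The empty graph is admitted because it is the union of the empty chain. *)
pose P (G : set (V * R)) := dominated_graph G /\ (G !=set0 -> G (x0, rnorm x0)).
have [F FP Ftot|G [[[GD GZ Gle] Gx0] Gmax]] := @Zorn_bigcup _ P.
  split; last first.
    by move=> [z [G FG Gz]]; exists G => //; apply: (FP _ FG).2; exists z.
  split.
  - move=> x r y s [G FG Gx] [H FH Hy].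
    have [GH|HG] := Ftot _ _ FG FH.
      by exists H => //; case: (FP _ FH) => -[HD _ _] _; apply: HD => //; apply: GH.
    by exists G => //; case: (FP _ FG) => -[GD _ _] _; apply: GD => //; apply: HG.
  - by move=> c x r [G FG Gx]; exists G => //; case: (FP _ FG) => -[_ GZ _] _; apply: GZ.
  - by move=> x r [G FG Gx]; case: (FP _ FG) => -[_ _ Gle] _; apply: Gle.
have Gn0 : G !=set0.
  apply/set0P/eqP => G0; apply: (Gmax [set (c%:C%C *: x0, c * rnorm x0) | c in setT]).
    split; first by rewrite G0; exact: sub0set.
    by rewrite G0 => /(_ (0%:C%C *: x0, 0 * rnorm x0)); apply; exists 0.
  split; last by move=> _; exists 1; rewrite // rmorph1 scale1r mul1r.
  split.
  - move=> _ _ _ _ [c _ [<- <-]] [d _ [<- <-]]; exists (c + d) => //.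
    by rewrite rmorphD/= scalerDl mulrDl.
  - move=> a _ _ [c _ [<- <-]]; exists (a * c) => //.
    by rewrite rmorphM/= scalerA mulrA.
  - move=> _ _ [c _ [<- <-]]; rewrite rnormZ ler_wpM2r ?ler_norm//.
    by rewrite -ler0c rnormE.
have Gtot v : exists r, G (v, r).
  have [|G' [G'd GG' [r G'v]]] := dominated_graph_extend v _ Gn0; first by split.
  exists r; have [//|nG] := pselect (G (v, r)).
  exfalso; apply: (Gmax G'); first by split=> // /(_ _ G'v).
  by split=> // _; apply/GG'/Gx0.
have Gfun v r s : G (v, r) -> G (v, s) -> r = s.
  have le a b : G (v, a) -> G (v, b) -> a <= b.
    move=> Ga /(GZ (-1))/(GD _ _ _ _ Ga)/Gle.
    by rewrite rmorphN rmorph1 scaleN1r mulN1r subrr rnorm0 subr_le0.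
  by move=> Ga Gb; apply/eqP; rewrite eq_le !le.
pose f v := sval (cid (Gtot v)); have fP v : G (v, f v) by rewrite /f; case: cid.
exists f; split=> [x y|c x|x|].
- by apply: Gfun (fP _) _; apply: GD.
- by apply: Gfun (fP _) _; apply: GZ.
- exact: Gle.
- by apply: Gfun (fP _) _; apply: Gx0.
Qed.

(** The complexification x |-> f x - i f (i x) of a real-linear norming functional; the
    constant 2 is crude, but any bound serves. *)
Lemma separating_functional (x0 : V) : x0 != 0 -> exists phi : V -> R[i],
  [/\ scalar phi, (forall x, `|phi x| <= 2 * `|x|) & phi x0 != 0].
Proof.
move=> x00; have [f [fD fZ fle fx0]] := real_norming_functional x0.
exists (fun x => (f x)%:C%C - 'i%C * (f ('i%C *: x))%:C%C); split.
- move=> a x y.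
  have faZ z : f (a *: z) = complex.Re a * f z + complex.Im a * f ('i%C *: z).
    by rewrite {1}[a]complexE scalerDl [_ * _%:C%C]mulrC -scalerA fD !fZ.
  rewrite scalerDr scalerA [_ * a]mulrC -scalerA !fD !faZ scalerA.
  have -> : f (('i%C * 'i%C) *: x) = - f x.
    by rewrite -expr2 sqr_i -[-1]/(- (1%:C)%C) -rmorphN fZ mulN1r.
  case: a {faZ} => a b; apply/eqP; rewrite eq_complex.
  by apply/andP; split; apply/eqP; rewrite /=; ring.
- move=> x.
  have fabs z : `|(f z)%:C%C| <= `|z|.
    rewrite normc_def/= expr0n addr0 sqrtr_sqr -rnormE lecR ler_norml fle andbT.
    rewrite lerNl -mulN1r -fZ rmorphN scaleN1r (le_trans (fle _))//.
    by rewrite /rnorm normrN.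
  have ni : `|'i%C : R[i]| = 1 by rewrite normc_def/= expr0n expr1n add0r sqrtr1.
  rewrite (le_trans (ler_normB _ _))// mulr_natl mulr2n lerD//.
  by rewrite normrM ni mul1r (le_trans (fabs _))// normrZ ni mul1r.
- apply/eqP => /(congr1 (@complex.Re R)) /=; rewrite !mul0r !mul1r fx0 => /eqP.
  rewrite !(subr0, oppr0, addr0) -(inj_eq (@complexI R)) rnormE normr_eq0.
  exact/negP.
Qed.

End HahnBanach.

(** * The algebra of bounded operators *)

Section OperatorAlgebra.
Variables (R : realType) (V : normedModType R[i]).

Lemma bopZE (k : R[i]) (f : bop V) x : (k *: f) x = k *: f x.
Proof. by []. Qed.

Lemma bop_scaleAl (k : R[i]) (f g : bop V) : k *: (f * g) = (k *: f) * g.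
Proof. exact/bopP. Qed.

Lemma bop_scaleAr (k : R[i]) (f g : bop V) : k *: (f * g) = f * (k *: g).
Proof. by apply/bopP => x; rewrite [RHS]linearZ. Qed.

Lemma bop_sumE (I : finType) (J : {set I}) (f : I -> bop V) x :
  (\sum_(i in J) f i) x = \sum_(i in J) f i x.
Proof. exact: (big_morph (fun g : bop V => g x)). Qed.

Lemma separating_eq0 (x : V) :
  (forall phi : V -> R[i], scalar phi -> (forall y, `|phi y| <= 2 * `|y|) ->
    phi x = 0) -> x = 0.
Proof.
move=> phi0; apply/eqP/negP => /negP /separating_functional[phi [lin bd /eqP]].
by apply; apply: phi0.
Qed.

Lemma scalar0 (phi : V -> R[i]) : scalar phi -> phi 0 = 0.
Proof. by move=> lin; have := lin (-1) 0 0; rewrite scaler0 addr0 mulN1r addNr. Qed.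

Lemma scalar_sum (phi : V -> R[i]) : scalar phi ->
  forall (I : finType) (J : {set I}) (c : I -> R[i]) (x : I -> V),
  phi (\sum_(i in J) c i *: x i) = \sum_(i in J) c i * phi (x i).
Proof.
move=> lin I J c x.
by elim/big_rec2: _ => [|i u v _ <-]; rewrite ?(scalar0 lin)// lin.
Qed.

Fact rank_one_subproof (phi : V -> R[i]) (x : V) : scalar phi ->
  (forall y, `|phi y| <= 2 * `|y|) -> (fun y => phi y *: x) \in @bounded_linear R V.
Proof.
move=> lin bd; apply/asboolP; split=> [k u v|].
  by rewrite lin scalerDl scalerA.
by exists (2 * `|x|) => y; rewrite normrZ mulrAC ler_wpM2r.
Qed.

(** Apply the hypothesis to the rank-one operator phi (x) x, and the result to y. *)
Lemma bop_tensor_functional (I : finType) (J : {set I}) (a b : I -> bop V) :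
  (forall T, \sum_(i in J) a i * T * b i = 0) ->
  forall phi : V -> R[i], scalar phi -> (forall y, `|phi y| <= 2 * `|y|) ->
  forall x y, \sum_(i in J) phi (b i y) *: a i x = 0.
Proof.
move=> ab phi lin bd x y.
have /(congr1 (fun g : bop V => g y)) := ab (Bop (rank_one_subproof x lin bd)).
rewrite bop_sumE => E; rewrite -[RHS]E; apply: eq_bigr => i _.
by rewrite !bop_mulE /= linearZ.
Qed.

(** The space is made part of the type because L(0) is the zero ring, whereas the
    algebra structures require 1 != 0. *)
Definition nzbop (nz : exists x : V, x != 0) : Type := bop V.
Variable nz : exists x : V, x != 0.
Local Notation L := (nzbop nz).

HB.instance Definition _ := GRing.Lmodule.on L.
HB.instance Definition _ := GRing.PzRing.on L.
Fact nzbop_oner_neq0 : (1 : L) != 0.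
Proof.
by apply/eqP => /(congr1 (fun g : bop V => g (sval (cid nz)))) /=; case: cid => x /= /eqP.
Qed.
HB.instance Definition _ := GRing.PzSemiRing_isNonZero.Build L nzbop_oner_neq0.
HB.instance Definition _ := GRing.Lmodule_isLalgebra.Build R[i] L (@bop_scaleAl).
HB.instance Definition _ := GRing.Lalgebra_isAlgebra.Build R[i] L (@bop_scaleAr).

Lemma nzbop_faithful : left_faithful L.
Proof.
move=> I J a b ab ind i iJ; apply/bopP => y; apply: separating_eq0 => phi lin bd.
apply: (ind (fun i => phi (b i y))) => //.
apply/bopP => x; rewrite -[RHS](bop_tensor_functional ab lin bd x y).
by rewrite [LHS]bop_sumE.
Qed.

(** Functionals are used on both sides here, through the identity
    phi (sum_i psi (a_i x) b_i y) = psi (sum_i phi (b_i y) a_i x). *)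
Lemma nzbop_faithful_converse : left_faithful L^c.
Proof.
move=> I J b a ab ind i iJ; apply/bopP => x; apply: separating_eq0 => psi linp bdp.
apply: (ind (fun i => psi (a i x))) => //.
apply/bopP => y; apply: separating_eq0 => phi lin bd.
have {}ab T : \sum_(i in J) (a i : bop V) * T * b i = 0.
  by rewrite -[RHS](ab T); apply: eq_bigr => j _; rewrite -mulrA.
rewrite [X in phi X]bop_sumE (scalar_sum lin).
under eq_bigr do rewrite mulrC; rewrite -(scalar_sum linp).
by rewrite (bop_tensor_functional ab lin bd) (scalar0 linp).
Qed.

End OperatorAlgebra.

(** * Inverting a large scalar plus an operator *)

Section Neumann.
Variables (R : realType) (X : completeNormedModType R[i]).

Section Contraction.
Variable W : bop X.
Hypothesis W_half : forall x, `|W x| <= 2^-1 * `|x|.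

(** The solution is the limit of the iterates of x |-> y - W x. *)
Lemma half_contraction_solve (y : X) : exists x, x + W x = y.
Proof.
pose u n := iter n (fun x => y - W x) 0.
have uS n : u n.+1 = y - W (u n) by [].
have u1 n : `|u n.+1 - u n| <= 2^-1 ^+ n * `|y|.
  elim: n => [|n IH]; first by rewrite /u/= raddf0 !subr0 expr0 mul1r.
  rewrite (uS n.+1) {2}(uS n) opprB addrC addrA subrK -raddfB /= (le_trans (W_half _))//.
  by rewrite exprS -mulrA ler_wpM2l ?invr_ge0// distrC.
have udist n m : `|u (n + m)%N - u n| <= (2 - 2 * 2^-1 ^+ m) * 2^-1 ^+ n * `|y|.
  elim: m => [|m IH]; first by rewrite addn0 subrr normr0 expr0 mulr1 subrr !mul0r.
  rewrite -(subrKA (u (n + m)%N)) addnS (le_trans (ler_normD _ _))//.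
  rewrite (le_trans (lerD (u1 _) IH))// -mulrDl ler_wpM2r// exprD exprS -subr_ge0.
  by rewrite [X in 0 <= X](_ : _ = 0)//; field.
have ucvg : cvg (u @ \oo).
  (* From 2 |y| / e < n < 2^n, the tail 2 |y| / 2^n of the geometric series is
     below e. *)
  apply: cauchy_cvg; apply: cauchy_exP => e e0.
  pose c : R[i] := 2 * `|y| / e.
  have c0 : 0 <= c by rewrite divr_ge0 ?mulr_ge0// ltW.
  pose n := Num.bound (complex.Re c).
  exists (u n); exists n => // k /= nk; rewrite -ball_normE /= distrC -(subnKC nk).
  rewrite (le_lt_trans (udist _ _))//.
  have cn : c < n%:R.
    rewrite -[c]RRe_real ?ger0_real// -(rmorph_nat (real_complex R)) ltcR.
    by apply: archi_boundP; rewrite -ler0c RRe_real ?ger0_real.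
  rewrite (@le_lt_trans _ _ (2^-1 ^+ n * (2 * `|y|)))//.
    rewrite mulrCA mulrA ler_wpM2r// ler_wpM2r ?exprn_ge0 ?invr_ge0//.
    by rewrite gerBl mulr_ge0 ?exprn_ge0 ?invr_ge0.
  rewrite exprVn ltr_pdivrMl ?exprn_gt0// -ltr_pdivrMr// -/c (lt_trans cn)//.
  by rewrite -natrX ltr_nat ltn_expl.
pose l := lim (u @ \oo); exists l; apply/eqP; rewrite -subr_eq0 -normr_eq0.
apply/negP => /negP dN0; set d := `|_| in dN0.
have d0 : 0 < d / 2 by rewrite divr_gt0// lt0r dN0 normr_ge0.
have /cvgrPdist_lt/(_ _ d0)[N _ HN] : u @ \oo --> l by [].
have : d < d.
  rewrite {1}/d; have -> : l + W l - y = (l - u N.+1) + W (l - u N).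
    by rewrite (raddfB W) (uS N) opprB [RHS]addrACA [X in _ = _ + X]addrAC subrr add0r.
  rewrite (le_lt_trans (ler_normD _ _))// [ltRHS]splitr ltr_leD//.
    by have := HN N.+1 (leqnSn N).
  have /ltW := HN N (leqnn N); apply: le_trans; apply: le_trans (W_half _) _.
  by rewrite ler_piMl// invf_le1// ler1n.
by rewrite ltxx.
Qed.

Lemma half_contraction_norm x : `|x| <= 2 * `|x + W x|.
Proof.
have h : `|x| <= `|x + W x| + 2^-1 * `|x|.
  by rewrite -{1}(addrK (W x) x) (le_trans (ler_normB _ _))// lerD2l W_half.
rewrite -(ler_pM2l (_ : 0 < 2^-1 :> R[i])) ?invr_gt0// mulrA mulVf ?pnatr_eq0// mul1r.
by rewrite -(lerD2r (2^-1 * `|x|)) (le_trans _ h)// -mulrDl -[2^-1]mul1r -splitr mul1r.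
Qed.

Lemma half_contraction_unit : exists U : bop X, (1 + W) * U = 1 /\ U * (1 + W) = 1.
Proof.
pose g y := sval (cid (half_contraction_solve y)).
have gP y : g y + W (g y) = y by rewrite /g; case: cid.
have ginj x y : x + W x = y + W y -> x = y.
  move=> xy; apply/eqP; rewrite -subr_eq0 -normr_eq0 eq_le normr_ge0 andbT.
  by rewrite (le_trans (half_contraction_norm _))// (raddfB W) addrACA -opprD xy subrr normr0 mulr0.
have gB : g \in @bounded_linear R X.
  apply/asboolP; split=> [k x y|].
    by apply: ginj; rewrite gP linearP addrACA -scalerDr !gP.
  by exists 2 => y; rewrite -{2}(gP y) half_contraction_norm.
exists (Bop gB); split; apply/bopP => x.
  by rewrite bop_mulE -[LHS]/(g x + W (g x)) gP.
by apply: ginj; rewrite bop_mulE /= gP.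
Qed.

End Contraction.

(** If k bounds U, the choice t = 2 (k + 1) makes U / t and - U / t shrink norms by
    at least one half. *)
Lemma bop_shift_unit (U : bop X) : exists2 t : R[i], t != 0 &
  (exists Y, (t *: (1 : bop X) + U) * Y = 1 /\ Y * (t *: (1 : bop X) + U) = 1) /\
  (exists Y, (t *: (1 : bop X) - U) * Y = 1 /\ Y * (t *: (1 : bop X) - U) = 1).
Proof.
have [k k0 kU] := bop_bound U.
pose t : R[i] := 2 * (k + 1).
have t0 : 0 < t by rewrite mulr_gt0// ltr_wpDl.
have tN0 : t != 0 by rewrite gt_eqF.
exists t => //.
have shift (Z : bop X) : (forall x, `|Z x| <= k * `|x|) ->
    exists Y, (t *: (1 : bop X) + Z) * Y = 1 /\ Y * (t *: (1 : bop X) + Z) = 1.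
  move=> kZ; have [|Y [ZY YZ]] := @half_contraction_unit (t^-1 *: Z).
    move=> x; rewrite bopZE normrZ normfV gtr0_norm// ler_pdivrMl//.
    rewrite (le_trans (kZ x))// mulrA ler_wpM2r// /t mulrAC mulfV ?pnatr_eq0// mul1r.
    by rewrite lerDl.
  have E : t *: (1 : bop X) + Z = t *: (1 + t^-1 *: Z).
    by rewrite scalerDr scalerA mulfV// scale1r.
  exists (t^-1 *: Y); rewrite E -!bop_scaleAl -!bop_scaleAr !scalerA.
  by rewrite mulfV// mulVf// !scale1r.
split; first exact: shift.
by apply: shift => x; rewrite -[(- U) x]/(- U x) normrN.
Qed.

End Neumann.

(** * Elementary operators of length two *)

Section Transfer.
Variables (R : realType) (X : completeNormedModType R[i]).

Lemma length2_nontrivial (D : bop (bop X)) : elementary_of_length 2 D ->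
  exists x : X, x != 0.
Proof.
move=> [_ Dmin]; apply: contrapT => /forallNP X0.
have [] : (2 <= 0)%N; last by [].
apply: Dmin; exists (fun=> 0), (fun=> 0); rewrite big_ord0; apply/bopP => T; apply/bopP => x.
by have /negP := X0 (D T x); rewrite negbK => /eqP.
Qed.

Lemma length2_rep (D : bop (bop X)) : elementary_of_length 2 D ->
  exists A1 B1 A2 B2 : bop X, D = mulop A1 B1 + mulop A2 B2.
Proof.
move=> [[A [B ->]] _]; exists (A ord0), (B ord0), (A ord_max), (B ord_max).
by rewrite big_ord_recl big_ord1; congr (_ + mulop (A _) (B _)); apply: val_inj.
Qed.

Lemma length2_not_mulop (D : bop (bop X)) A B : elementary_of_length 2 D ->
  D <> mulop A B.
Proof.
move=> [_ Dmin] DE; have [] : (2 <= 1)%N; last by [].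
by apply: Dmin; exists (fun=> A), (fun=> B); rewrite big_ord1.
Qed.

Lemma mulopM (A B C E : bop X) : mulop A B * mulop C E = mulop (A * C) (E * B).
Proof. by apply/bopP => T; rewrite bop_mulE !mulopE !mulrA. Qed.

Lemma mulop_invertible (A B : bop X) :
  (exists A', A * A' = 1 /\ A' * A = 1) -> (exists B', B * B' = 1 /\ B' * B = 1) ->
  invertible (mulop A B).
Proof.
move=> [A' [AA' A'A]] [B' [BB' B'B]]; exists (mulop A' B').
by rewrite /is_inverse !mulopM AA' A'A BB' B'B; split; apply/bopP => T;
  rewrite mulopE mul1r mulr1.
Qed.

End Transfer.

Theorem theorem10 (R : realType) (X : completeNormedModType R[i])
    (Delta DeltaV : bop (bop X)) :
  elementary_of_length 2 Delta ->
  is_inverse Delta DeltaV ->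
  elementary_of_length 2 DeltaV ->
  exists M1 M2 G1 G2 : bop (bop X),
    [/\ is_mulop M1, is_mulop M2, is_mulop G1 & is_mulop G2] /\
    Delta = M1 + M2 /\
    DeltaV = G1 + G2 /\
    ((invertible M1 /\ invertible M2) \/
     [/\ G1 * M2 = 0, M2 * G1 = 0, G2 * M1 = 0 & M1 * G2 = 0]).
Proof.
move=> lenD [DG GD] lenG; have nz := length2_nontrivial lenD.
have [A1 [B1 [A2 [B2 DE]]]] := length2_rep lenD.
have [C1 [D1 [C2 [D2 GE]]]] := length2_rep lenG.
have rep_mulop (E : bop (bop X)) (a b c d : bop X) :
    @rep _ (nzbop nz) E a b c d <-> E = mulop a b + mulop c d.
  split=> [EE|-> T //]; apply/bopP => T; exact: EE.
have not_single_length2 E : elementary_of_length 2 E -> @not_single _ (nzbop nz) E.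
  by move=> lenE A B EE; apply: (length2_not_mulop (A := A) (B := B) lenE); apply/bopP.
have [a1 [b1 [a2 [b2 [c1 [d1 [c2 [d2 [/rep_mulop DE' [/rep_mulop GE' H]]]]]]]]]] :=
  inverse_dichotomy (@nzbop_faithful _ _ nz) (@nzbop_faithful_converse _ _ nz)
    (@bop_shift_unit _ X) (iffRL (rep_mulop _ _ _ _ _) DE) (iffRL (rep_mulop _ _ _ _ _) GE)
    (fun T => congr1 (fun E : bop (bop X) => E T) GD)
    (fun T => congr1 (fun E : bop (bop X) => E T) DG)
    (not_single_length2 _ lenD) (not_single_length2 _ lenG).
exists (mulop a1 b1), (mulop a2 b2), (mulop c1 d1), (mulop c2 d2).
split; first by split; [exists a1, b1 | exists a2, b2 | exists c1, d1 | exists c2, d2].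
split=> //; split=> //; case: H => [[]|[z1 z2 z3 z4]]; [left|right].
  by split; apply: mulop_invertible.
by rewrite !mulopM; split; apply/bopP.
Qed.
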